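(* Let $E$ be a normalized symmetric Banach sequence space with order continuous norm or $E = \ell^\infty$, and let $G \subset \mathrm{Aut}^+_s(E)$ be a compact group. Then there exist a unique compact group $H \subset S(\mathbb{N})$ and an $m \in (\ell^\infty)^{++}$ such that \[ G = mHm^{-1}. \] Conversely, if $H \subset S(\mathbb{N})$ is a compact group and $m \in (\ell^\infty)^{++}$, then $G := mHm^{-1}$ is a compact subgroup of $\mathrm{Aut}^+_s(E)$.
   Context: A normalized symmetric Banach sequence space is a Banach lattice $E$ of real sequences (indexed by $\mathbb{N}$), with the pointwise ordering and lattice operations, such that: if $x\in E$ and $y$ is a sequence with $|y|\le|x|$, then $y\in E$ and $\|y\|\le\|x\|$; permutations of sequences in $E$ remain in $E$ with the same norm; and the standard unit vectors $e_n$ ($n\in\mathbb{N}$) have norm $1$. $\mathrm{Aut}^+_s(E)$ is the group of lattice automorphisms of $E$ with the strong operator topology. $S(\mathbb{N})$ is the group of permutations of $\mathbb{N}$, identified with the group of permutation operators on $E$, $(\phi x)_n := x_{\phi^{-1}(n)}$, and it carries the strong operator topology as a subset of $\mathrm{Aut}^+_s(E)$; it equals the group of isometric lattice automorphisms of $E$. $(\ell^\infty)^{++}$ is the set of $m\in\ell^\infty$ for which there is a $\delta>0$ with $m_n\ge\delta$ for all $n$; such $m$ is identified with the operator of pointwise multiplication by $m$ on $E$. *)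

(* Defs.v *)
From mathcomp Require Import all_boot all_order all_algebra.
From mathcomp Require Import all_classical all_reals all_analysis.

Set Implicit Arguments.
Unset Strict Implicit.
Unset Printing Implicit Defensive.

Import Order.TTheory GRing.Theory Num.Theory.
Import numFieldNormedType.Exports.

Local Open Scope classical_set_scope.
Local Open Scope ring_scope.

(* A Banach space of real sequences is encoded as a complete normed space E with
   an injective linear map [coord] listing the coordinates of its elements; E is
   identified with the range of [coord].
   [sym_solid] makes this range closed under x |-> |x|, hence under pointwise
   maxima and minima (see [coord_join] and [coord_meet]), and makes the norm a
   lattice norm, so that E is a Banach lattice for the pointwise order. *)
Record symSeqSpace (R : realType) := SymSeqSpace {
  sym_sort :> completeNormedModType R ;
  coord : sym_sort -> nat -> R ;
  coord_linear : forall n, scalar (coord^~ n) ;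
  coord_inj : injective coord ;
  sym_solid : forall (x : sym_sort) (s : nat -> R),
    (forall n, `|s n| <= `|coord x n|) ->
    exists2 y, coord y = s & `|y| <= `|x| ;
  sym_perm : forall (x : sym_sort) (s : nat -> nat), bijective s ->
    exists2 y, coord y = coord x \o s & `|y| = `|x| ;
  sym_unit : forall n,
    exists2 e, coord e = (fun k => (k == n)%:R) & `|e| = 1
}.

Section SymSeqSpace.
Context {R : realType} {E : symSeqSpace R}.
Implicit Types (x y : E) (s m : nat -> R) (T : E -> E).

(* The element of E with coordinates s; the junk value 0 if s is not in E. *)
Definition of_seq s : E := xget 0 [set x | coord x = s].

Lemma of_seqK s x : coord x = s -> coord (of_seq s) = s.
Proof. by move=> xs; rewrite /of_seq; case: xgetP => [z _ //|/(_ x)]. Qed.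

Lemma of_seq_solid s x :
  (forall n, `|s n| <= `|coord x n|) -> coord (of_seq s) = s.
Proof. by case/sym_solid => y /of_seqK. Qed.

Definition leS x y := forall n, coord x n <= coord y n.

Definition join x y : E := of_seq (fun n => Num.max (coord x n) (coord y n)).
Definition meet x y : E := of_seq (fun n => Num.min (coord x n) (coord y n)).

Lemma coordD x y n : coord (x + y) n = coord x n + coord y n.
Proof. by have := coord_linear n 1 x y; rewrite scale1r mul1r. Qed.

Lemma abs_sum_in x y : exists z : E,
  coord z = fun n => `|coord x n| + `|coord y n|.
Proof.
have [|a ax _] := @sym_solid _ _ x (fun n => `|coord x n|).
  by move=> n; rewrite normr_id.
have [|b bx _] := @sym_solid _ _ y (fun n => `|coord y n|).
  by move=> n; rewrite normr_id.
by exists (a + b); apply/funext => n; rewrite coordD ax bx.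
Qed.

Lemma coord_join x y n : coord (join x y) n = Num.max (coord x n) (coord y n).
Proof.
have [z zE] := abs_sum_in x y; rewrite /join (@of_seq_solid _ z) // => k.
rewrite zE [leRHS]ger0_norm ?addr_ge0//; case: (leP (coord x k)) => _;
  by rewrite ?lerDl ?lerDr.
Qed.

Lemma coord_meet x y n : coord (meet x y) n = Num.min (coord x n) (coord y n).
Proof.
have [z zE] := abs_sum_in x y; rewrite /meet (@of_seq_solid _ z) // => k.
rewrite zE [leRHS]ger0_norm ?addr_ge0//; case: (leP (coord x k)) => _;
  by rewrite ?lerDl ?lerDr.
Qed.

Definition lattice_automorphism T :=
  [/\ linear T, bijective T,
      (forall x y, T (join x y) = join (T x) (T y)) &
      (forall x y, T (meet x y) = meet (T x) (T y))].

(* A set of operators is a group under composition, compact for the strong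
   operator topology, i.e. the topology of pointwise convergence in norm.
   Compactness is intrinsic, hence it may be expressed in the space of all maps
   E -> E. *)
Definition compact_group (G : set (E -> E)) :=
  [/\ G id,
      (forall S T, G S -> G T -> G (S \o T)),
      (forall T, G T -> exists T', [/\ G T', cancel T T' & cancel T' T]) &
      compact (G : set {ptws E -> E})].

Definition perm_op (t : nat -> nat) x : E := of_seq (coord x \o t).

Lemma coord_perm_op (t : nat -> nat) x :
  bijective t -> coord (perm_op t x) = coord x \o t.
Proof. by move=> /(sym_perm x)[y /of_seqK]. Qed.

(* S(N); the operator of the permutation s involves the inverse t of s. *)
Definition perm_operators : set (E -> E) :=
  [set T | exists s t : nat -> nat,
    [/\ cancel s t, cancel t s & T = perm_op t]].

Definition mul_op m x : E := of_seq (fun n => m n * coord x n).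

Lemma coord_mul_op m x n :
  bounded_fun m -> coord (mul_op m x) n = m n * coord x n.
Proof.
move=> [M [_ /(_ (`|M| + 1))]].
rewrite (le_lt_trans (ler_norm M)) ?ltrDl// => /(_ isT) mM.
rewrite /mul_op (@of_seq_solid _ ((`|M| + 1) *: x)) // => k.
have := coord_linear k (`|M| + 1) x 0; rewrite addr0 => ->.
have c0 : coord (0 : E) k = 0.
  by apply: (addrI (coord (0 : E) k)); rewrite -coordD !addr0.
rewrite c0 addr0 !normrM ler_wpM2r//.
by apply: (le_trans (mM k I)); rewrite ger0_norm ?addr_ge0.
Qed.

(* The group m H m^-1. *)
Definition mul_conj m (H : set (E -> E)) : set (E -> E) :=
  [set mul_op m \o T \o mul_op (fun n => (m n)^-1) | T in H].

End SymSeqSpace.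

Section Hypotheses.
Context {R : realType}.

(* (l^infty)^{++} *)
Definition linfty_pp : set (nat -> R) :=
  [set m : nat -> R | bounded_fun m /\ exists2 d, 0 < d & forall n, d <= m n].

Lemma linfty_ppV (m : nat -> R) :
  linfty_pp m -> linfty_pp (fun n => (m n)^-1).
Proof.
move=> [[M [_ /(_ (`|M| + 1))]]].
rewrite (le_lt_trans (ler_norm M)) ?ltrDl// => /(_ isT) mM [d d0 dm].
have m0 n : 0 < m n by exact: lt_le_trans (dm n).
split; last first.
  exists (`|M| + 1)^-1 => [|n]; first by rewrite invr_gt0 ltr_wpDl.
  rewrite lef_pV2 ?posrE ?ltr_wpDl//.
  by apply: le_trans (mM n I); exact: ler_norm.
exists d^-1; split; first exact: num_real.
move=> c dc n _ /=; rewrite ger0_norm ?invr_ge0 ?(ltW (m0 n))//.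
by apply: le_trans (ltW dc); rewrite lef_pV2 ?posrE.
Qed.

Variable E : symSeqSpace R.

(* Every downward directed set with infimum 0 in E has norms with infimum 0;
   equivalently, |x_i| tends to 0 for every decreasing net x_i with infimum 0. *)
Definition order_continuous_norm :=
  forall D : set E, D !=set0 ->
    (forall x y, D x -> D y -> exists z, [/\ D z, leS z x & leS z y]) ->
    (forall x, D x -> leS 0 x) ->
    (forall z, (forall x, D x -> leS z x) -> leS z 0) ->
    inf [set `|x| | x in D] = 0.

Definition is_linfty :=
  range (@coord R E) = [set s : nat -> R | bounded_fun s] /\
  forall x : E, `|x| = sup (range (fun n => `|coord x n|)).

End Hypotheses.

(* Main.v *)
(** Unit vectors are atoms of the lattice, so a lattice automorphism T has the
    form (T x)_n = w_n * x_(t n) with t a permutation and w > 0.  On a compact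
    group G of such T the weights are uniformly bounded: otherwise a gliding
    hump x = sum_i 2^-i e_(n_i) would have an unbounded orbit.  Hence
    m_n := sup_(T in G) w_T n is finite, and bounded below by w_id = 1.  As
    w_(S T) n = w_S n * w_T (t_S n) and S G = G, one gets
    m n = w_S n * m (t_S n): every m^-1 S m is a permutation operator.
    The permutation t is determined by m S m^-1, whence the uniqueness of H. *)
From HB Require Import structures.
Require Import Defs.
From mathcomp Require Import all_boot all_order all_algebra.
From mathcomp Require Import all_classical all_reals all_analysis.
(* [vector.coord] would otherwise shadow [Defs.coord] *)
Import Defs.
Set Implicit Arguments.
Unset Strict Implicit.
Local Open Scope classical_set_scope.
Local Open Scope ring_scope.
Import Order.TTheory GRing.Theory Num.Theory.
Import numFieldNormedType.Exports.

(** * Bounded linear maps and the topology of pointwise convergence *)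

Lemma bounded_linear_map_continuous {R : realType} {V W : normedModType R}
    (f : V -> W) (M : R) :
  linear f -> (forall x, `|f x| <= M * `|x|) -> continuous f.
Proof.
move=> lf fM.
pose F : {linear V -> W} := HB.pack f (GRing.isLinear.Build _ _ _ _ f lf).
apply: (@bounded_linear_continuous _ _ _ F).
exists `|M|; split; first exact: num_real.
move=> c Mc; near=> x => /=.
apply: le_trans (fM x) _; apply: le_trans (ltW Mc).
(* [M] may be negative, hence the passage to its absolute value; near 0 the factor [|x|] is at most
   1. *)
rewrite (@le_trans _ _ (`|M| * `|x|)) ?ler_wpM2r ?ler_norm//.
rewrite ler_piMr// ltW//.
Unshelve. all: by end_near. Qed.

Lemma ptws_continuous (S U : topologicalType) (V : uniformType)
    (F : S -> {ptws U -> V}) :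
  (forall x, continuous (fun s => F s x)) -> continuous F.
Proof. by move=> cF s; apply/(@pointwise_cvgP U V (F @ s)) => x; exact: cF. Qed.

Lemma ptws_eval_continuous (U : topologicalType) (V : uniformType) (x : U) :
  continuous (fun f : {ptws U -> V} => f x).
Proof. exact: (@proj_continuous U (fun=> V) x). Qed.

Lemma bounded_set_le {R : realType} {V : normedModType R} (A : set V) :
  bounded_set A -> exists M : R, forall x, A x -> `|x| <= M.
Proof.
move=> [M [_ MA]]; exists (M + 1) => x Ax.
by apply: (MA (M + 1)) => //; rewrite ltrDl.
Qed.

(** * Coordinate functionals and unit vectors *)

Section Coordinates.
Context {R : realType} {E : symSeqSpace R}.
Implicit Types (x y : E) (n : nat).

Lemma coord0 n : coord (0 : E) n = 0.
Proof. by apply: (addrI (coord (0 : E) n)); rewrite -coordD !addr0. Qed.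

Lemma coordZ (a : R) x n : coord (a *: x) n = a * coord x n.
Proof. by have := coord_linear n a x 0; rewrite addr0 coord0 addr0. Qed.

Lemma coordN x n : coord (- x) n = - coord x n.
Proof. by rewrite -scaleN1r coordZ mulN1r. Qed.

Lemma coordB x y n : coord (x - y) n = coord x n - coord y n.
Proof. by rewrite coordD coordN. Qed.

Lemma coord_ext x y : coord x =1 coord y -> x = y.
Proof. by move=> xy; apply: coord_inj; exact/funext. Qed.

Lemma norm_solid x y : (forall n, `|coord x n| <= `|coord y n|) -> `|x| <= `|y|.
Proof. by case/sym_solid => z /coord_inj ->. Qed.

Definition unit_vec n : E := of_seq (fun k => (k == n)%:R).

Lemma coord_unit_vec n k : coord (unit_vec n) k = (k == n)%:R.
Proof. by have [e /of_seqK + _] := sym_unit E n => ->. Qed.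

Lemma norm_unit_vec n : `|unit_vec n| = 1.
Proof.
have [e ek <-] := sym_unit E n; congr `|_|; apply: coord_ext => k.
by rewrite coord_unit_vec ek.
Qed.

(** The vector [coord x n *: unit_vec n] is dominated coordinatewise by [x], and unit vectors have
    norm 1. *)
Lemma coord_le_norm x n : `|coord x n| <= `|x|.
Proof.
rewrite -[leLHS]mulr1 -(norm_unit_vec n) -normrZ; apply: norm_solid => k.
rewrite coordZ coord_unit_vec; case: eqP => [->|_]; first by rewrite mulr1.
by rewrite mulr0 normr0.
Qed.

Lemma coord_continuous n : continuous (fun x => coord x n).
Proof.
apply: (@bounded_linear_map_continuous R E R^o _ 1) => [|x].
  exact: coord_linear.
by rewrite mul1r; exact: coord_le_norm.
Qed.

End Coordinates.

(** * Weighted permutation operators *)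

Section WeightedPermutations.
Context {R : realType} {E : symSeqSpace R}.
Implicit Types (x y : E) (S T : E -> E) (w m : nat -> R) (t : nat -> nat).

(** When [t] is bijective, [T] sends [unit_vec (t n)] to [w n *: unit_vec n], so [t] is the inverse
    of the permutation induced on the unit vectors. Positivity of [w] and bijectivity of [t] are
    assumed separately where they are used. *)
Definition weighted_perm T w t :=
  forall x n, coord (T x) n = w n * coord x (t n).

Lemma weighted_perm_comp S T w w' t t' :
  weighted_perm S w t -> weighted_perm T w' t' ->
  weighted_perm (S \o T) (fun n => w n * w' (t n)) (t' \o t).
Proof. by move=> Swt Twt x n; rewrite /= Swt Twt mulrA. Qed.

Lemma weighted_perm_id : weighted_perm id (fun=> 1) id.
Proof. by move=> x n; rewrite mul1r. Qed.

(** Coordinate [n] of [T (unit_vec (t n))] is [w n] in one representation and [w' n] or 0 in the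
    other, according to whether [t' n = t n]; positivity of [w n] excludes 0. *)
Lemma weighted_perm_uniq T w w' t t' : (forall n, 0 < w n) ->
  weighted_perm T w t -> weighted_perm T w' t' -> w =1 w' /\ t =1 t'.
Proof.
move=> w0 Twt Twt'.
have ww' n : w n = w' n * (t' n == t n)%:R.
  have := Twt (unit_vec (t n)) n.
  by rewrite Twt' !coord_unit_vec eqxx mulr1 => <-.
suff tt' n : t' n = t n by split => n //; rewrite ww' tt' eqxx mulr1.
apply/eqP; have := w0 n; rewrite ww'; case: eqP => // _.
by rewrite mulr0 ltxx.
Qed.

Lemma weighted_perm_perm_op t : bijective t ->
  weighted_perm (perm_op t) (fun=> 1) t.
Proof. by move=> bt x n; rewrite coord_perm_op// mul1r. Qed.

Lemma weighted_perm_mul_op m : linfty_pp m -> weighted_perm (mul_op m) m id.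
Proof. by move=> [bm _] x n; rewrite coord_mul_op. Qed.

Lemma weighted_perm_lattice_automorphism T w t : (forall n, 0 <= w n) ->
  bijective T -> weighted_perm T w t -> lattice_automorphism T.
Proof.
move=> w0 bT Twt; split => // [a x y|x y|x y]; apply: coord_ext => n.
- by rewrite coordD coordZ !Twt coordD coordZ mulrDr mulrCA.
- by rewrite Twt !coord_join maxr_pMr// -!Twt.
- by rewrite Twt !coord_meet minr_pMr// -!Twt.
Qed.

(** * Lattice automorphisms as weighted permutations *)

Lemma lattice_automorphism_inv S T : cancel S T -> cancel T S ->
  lattice_automorphism T -> lattice_automorphism S.
Proof.
move=> STK TSK [lT bT Tj Tm]; split => [a x y||x y|x y]; last 2 first.
- by apply: (can_inj TSK); rewrite Tj !STK.
- by apply: (can_inj TSK); rewrite Tm !STK.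
- by apply: (can_inj TSK); rewrite lT !STK.
- by exists T.
Qed.

(** Turns the vanishing of a coordinate into disjointness from an atom, a condition that lattice
    automorphisms transport. *)
Lemma meet_unit_vec0 x n : (forall k, 0 <= coord x k) ->
  meet x (unit_vec n) = 0 <-> coord x n = 0.
Proof.
move=> x0; split => [/(congr1 (fun y => coord y n))|xn].
  rewrite coord_meet coord_unit_vec eqxx coord0 /Order.min.
  by case: ifP => // _ /eqP; rewrite oner_eq0.
apply: coord_ext => k; rewrite coord_meet coord_unit_vec coord0.
by case: eqP => [->|_]; [rewrite xn min_l|rewrite min_r].
Qed.

(** The order is encoded by the identity [join x y = y], which [T] preserves. *)
Lemma lattice_automorphism_leS T x y : lattice_automorphism T ->
  leS x y -> leS (T x) (T y).
Proof.
move=> [_ _ Tj _] xy n; rewrite -[X in _ <= coord (T X) n](_ : join x y = y).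
  by rewrite Tj coord_join le_max lexx.
by apply: coord_ext => k; rewrite coord_join max_r.
Qed.

Lemma lattice_automorphism0 T : lattice_automorphism T -> T 0 = 0.
Proof.
move=> [lT _ _ _]; have := lT (-1) 0 0.
by rewrite scaler0 addr0 scaleN1r addNr.
Qed.

Lemma lattice_automorphismZ T (a : R) x : lattice_automorphism T ->
  T (a *: x) = a *: T x.
Proof.
move=> aT; have [lT _ _ _] := aT.
by have := lT a x 0; rewrite (lattice_automorphism0 aT) !addr0.
Qed.

Lemma lattice_automorphismN T x : lattice_automorphism T -> T (- x) = - T x.
Proof. by move=> aT; rewrite -scaleN1r lattice_automorphismZ// scaleN1r. Qed.

Lemma lattice_automorphismB T x y : lattice_automorphism T ->
  T (x - y) = T x - T y.
Proof.
move=> [lT _ _ _]; have := lT (-1) y x.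
by rewrite !scaleN1r ![- _ + _]addrC.
Qed.

(* If c > 0 is a coordinate of T e_n, at k, then 0 <= T^-1 (c e_k) <= e_n, so
   that T^-1 (c e_k) is a multiple of the atom e_n. *)
Lemma lattice_automorphism_unit_vec T n : lattice_automorphism T ->
  exists k, exists2 c : R, 0 < c & T (unit_vec n) = c *: unit_vec k.
Proof.
move=> aT; have [lT [S TSK STK] Tj Tm] := aT.
have aS := lattice_automorphism_inv STK TSK aT.
have Te0 k : 0 <= coord (T (unit_vec n)) k.
  rewrite -(@coord0 _ E k) -{1}(lattice_automorphism0 aT).
  apply: lattice_automorphism_leS => // j.
  by rewrite coord0 coord_unit_vec ler0n.
have [k ck] : exists k, 0 < coord (T (unit_vec n)) k.
  apply: contrapT => /forallNP Tn.
  have : T (unit_vec n) = T 0.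
    rewrite lattice_automorphism0//; apply: coord_ext => k.
    by apply/eqP; rewrite coord0 eq_le Te0 andbT leNgt; exact/negP.
  move=> /(can_inj TSK) /(congr1 (fun y => coord y n)).
  by rewrite coord_unit_vec eqxx coord0 => /eqP; rewrite oner_eq0.
exists k; set c := coord _ k in ck; exists c => //.
pose y := S (c *: unit_vec k).
have y0 j : 0 <= coord y j.
  rewrite -(@coord0 _ E j) -(lattice_automorphism0 aS).
  apply: lattice_automorphism_leS => // i.
  by rewrite coord0 coordZ coord_unit_vec mulr_ge0// ltW.
have ye : leS y (unit_vec n).
  rewrite -(TSK (unit_vec n)); apply: lattice_automorphism_leS => // i.
  by rewrite coordZ coord_unit_vec; case: eqP => [->|_];
    rewrite ?mulr1// mulr0.
have yE : y = coord y n *: unit_vec n.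
  apply: coord_ext => j; rewrite coordZ coord_unit_vec.
  case: eqP => [->|/eqP jn]; first by rewrite mulr1.
  apply/eqP; rewrite mulr0 eq_le y0 andbT.
  by have := ye j; rewrite coord_unit_vec (negPf jn).
have : T y = coord y n *: T (unit_vec n).
  by rewrite {1}yE lattice_automorphismZ.
rewrite /y STK => cE.
(* The [k]-th coordinates in [cE] give [c = coord y n * c], with [c] nonzero. *)
suff y1 : coord y n = 1 by rewrite cE y1 scale1r.
have := congr1 (fun z => coord z k) cE.
rewrite /= !coordZ coord_unit_vec eqxx mulr1 -/c => /eqP.
by rewrite -subr_eq0 -{1}[c]mul1r -mulrBl mulf_eq0 (gt_eqF ck) orbF
  subr_eq0 => /eqP <-.
Qed.

(** [T] and its inverse both map atoms to positive multiples of atoms, which yields [s] and [t].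
    That [T x] at [n] depends only on [x] at [t n] follows from preservation of disjointness. *)
Lemma lattice_automorphism_weighted_perm T : lattice_automorphism T ->
  exists w s t, [/\ cancel s t, cancel t s, forall n, 0 < w n &
                    weighted_perm T w t].
Proof.
move=> aT; have [_ [S TSK STK] _ Tm] := aT.
have aS := lattice_automorphism_inv STK TSK aT.
have /choice[s sP] n : exists k, exists2 c : R, 0 < c &
    T (unit_vec n) = c *: unit_vec k := lattice_automorphism_unit_vec n aT.
have /choice[t tP] n : exists k, exists2 c : R, 0 < c &
    S (unit_vec n) = c *: unit_vec k := lattice_automorphism_unit_vec n aS.
have unit_vec_inj (a : R) n k : unit_vec n = a *: unit_vec k :> E -> n = k.
  move=> /(congr1 (fun z => coord z n)); rewrite coordZ !coord_unit_vec eqxx.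
  by case: eqP => // _ /eqP; rewrite mulr0 oner_eq0.
have stK : cancel s t.
  move=> n; have [c c0 Te] := sP n; have [d d0 Se] := tP (s n).
  have := congr1 S Te; rewrite TSK lattice_automorphismZ// Se scalerA.
  by move/unit_vec_inj.
have tsK : cancel t s.
  move=> n; have [c c0 Te] := tP n; have [d d0 Se] := sP (t n).
  have := congr1 T Te; rewrite STK lattice_automorphismZ// Se scalerA.
  by move/unit_vec_inj.
have /choice[w wP] n : exists c : R, 0 < c /\
    T (unit_vec (t n)) = c *: unit_vec n.
  by have [c c0] := sP (t n); rewrite tsK; exists c.
exists w, s, t; split => // [n|x n]; first by have [] := wP n.
have [w0 Te] := wP n.
(* With its coordinate at [t n] removed, the absolute value of [x'], written as [join x' (- x')], is
   disjoint from [unit_vec (t n)]. Applying [T] makes that of [T x'] disjoint from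
   [w n *: unit_vec n], and [w n > 0]. *)
pose x' := x - coord x (t n) *: unit_vec (t n).
have x'0 : coord x' (t n) = 0.
  by rewrite coordB coordZ coord_unit_vec eqxx mulr1 subrr.
suff : coord (T x') n = 0.
  rewrite lattice_automorphismB// coordB lattice_automorphismZ// Te scalerA.
  rewrite coordZ coord_unit_vec eqxx mulr1 mulrC => /eqP.
  by rewrite subr_eq0 => /eqP.
have absE (z : E) k : coord (join z (- z)) k = `|coord z k|.
  by rewrite coord_join coordN maxrN.
have d0 : meet (join x' (- x')) (unit_vec (t n)) = 0.
  by apply/meet_unit_vec0 => [k|]; rewrite absE ?x'0 ?normr0.
have [_ _ Tj _] := aT.
have := congr1 T d0.
rewrite Tm Tj lattice_automorphismN// lattice_automorphism0// Te.
move=> /(congr1 (fun z => coord z n)); rewrite coord_meet absE coordZ.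
rewrite coord_unit_vec eqxx mulr1 coord0 /Order.min; case: ifP => _.
  by move/normr0P/eqP.
by move=> /eqP; rewrite (gt_eqF w0).
Qed.


(** * Conjugation by multiplication operators *)

Lemma mul_opK m : linfty_pp m ->
  cancel (@mul_op _ E m) (mul_op (fun n => (m n)^-1)).
Proof.
move=> mP; have [_ [d d0 dm]] := mP; move=> x; apply: coord_ext => n.
rewrite (weighted_perm_mul_op (linfty_ppV mP)) (weighted_perm_mul_op mP).
by rewrite mulKf// gt_eqF// (lt_le_trans d0).
Qed.

Lemma mul_opVK m : linfty_pp m ->
  cancel (mul_op (fun n => (m n)^-1)) (@mul_op _ E m).
Proof.
move=> mP; have := mul_opK (linfty_ppV mP); congr (cancel _ (mul_op _)).
by apply/funext => n; rewrite invrK.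
Qed.

Lemma mul_op_continuous m : linfty_pp m -> continuous (@mul_op _ E m).
Proof.
move=> mP; have [[M [_ MP]] _] := mP.
have mM : forall n, `|m n| <= M + 1 by move=> n; apply: MP => //; rewrite ltrDl.
apply: (@bounded_linear_map_continuous _ _ _ _ `|M + 1|) => [a x y|x].
  apply: coord_ext => n.
  rewrite coordD coordZ !(weighted_perm_mul_op mP) coordD coordZ.
  by rewrite mulrDr mulrCA.
rewrite -normrZ; apply: norm_solid => n.
rewrite coordZ (weighted_perm_mul_op mP) !normrM ler_wpM2r//.
by apply: le_trans (ler_norm (M + 1)); exact: mM.
Qed.

(** Evaluating the conjugate of [T] at [x] applies the continuous [mul_op m] to the value of [T] at
    a fixed vector, so conjugation is continuous for pointwise convergence. With [G] arbitrary, this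
    serves both to pass from [H] to [G] and back. *)
Lemma compact_group_mul_conj m (G : set (E -> E)) : linfty_pp m ->
  compact_group G -> compact_group (mul_conj m G).
Proof.
move=> mP [G1 GM GV cG]; split.
- exists id => //; apply/funext => x /=; exact: mul_opVK.
- move=> _ _ [S GS <-] [T GT <-]; exists (S \o T); first exact: GM.
  by apply/funext => x /=; rewrite mul_opK.
- move=> _ [T /[dup] GT /GV[S [GS TSK STK]] <-].
  exists (mul_op m \o S \o mul_op (fun n => (m n)^-1)); split.
  + by exists S.
  + by move=> x /=; rewrite mul_opK// TSK mul_opVK.
  + by move=> x /=; rewrite mul_opK// STK mul_opVK.
- apply: (@continuous_compact {ptws E -> E} {ptws E -> E}) => //.
  apply: continuous_subspaceT; apply: ptws_continuous => x T.
  apply: (@continuous_comp {ptws E -> E} E E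
    (fun S => S (mul_op (fun n => (m n)^-1) x))).
    exact: (@ptws_eval_continuous E E).
  exact: mul_op_continuous.
Qed.

Lemma mul_conjK m (G : set (E -> E)) : linfty_pp m ->
  mul_conj m (mul_conj (fun n => (m n)^-1) G) = G.
Proof.
move=> mP; have mV : (fun n => (m n)^-1^-1) = m.
  by apply/funext => n; rewrite invrK.
have conjK T : mul_op m \o (mul_op (fun n => (m n)^-1) \o T \o
    mul_op (fun n => (m n)^-1^-1)) \o mul_op (fun n => (m n)^-1) = T.
  by apply/funext => x /=; rewrite mV !mul_opVK.
apply/seteqP; split => [_ [_ [T GT <-] <-]|T GT]; first by rewrite conjK.
by rewrite -(conjK T); do 2 (eexists; last reflexivity).
Qed.

Lemma weighted_perm_mul_conj m T w t : linfty_pp m -> weighted_perm T w t ->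
  weighted_perm (mul_op m \o T \o mul_op (fun n => (m n)^-1))
    (fun n => m n * w n * (m (t n))^-1) t.
Proof.
move=> mP Twt x n /=.
rewrite (weighted_perm_mul_op mP) Twt (weighted_perm_mul_op (linfty_ppV mP)).
by rewrite !mulrA.
Qed.

(** Conjugation changes the weights but not the index map, so equal conjugates come from the same
    permutation even when [m] and [m'] differ. Exchanging the roles gives the reverse inclusion. *)
Lemma mul_conj_perm_operators_sub m m' (H H' : set (E -> E)) :
  linfty_pp m -> linfty_pp m' ->
  H `<=` perm_operators -> H' `<=` perm_operators ->
  mul_conj m H = mul_conj m' H' -> H `<=` H'.
Proof.
move=> mP mP' HP HP' HH' T HT.
have m0 n : 0 < m n by have [_ [d d0 dm]] := mP; exact: lt_le_trans (dm n).
have : mul_conj m' H' (mul_op m \o T \o mul_op (fun n => (m n)^-1)).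
  by rewrite -HH'; exists T.
have [s [t [stK tsK TE]]] := HP _ HT.
move=> [T' HT'].
have [s' [t' [stK' tsK' TE']]] := HP' _ HT'.
have bt : bijective t by exists s.
have bt' : bijective t' by exists s'.
have := weighted_perm_mul_conj mP' (weighted_perm_perm_op bt').
rewrite -TE' => /[swap] ->.
have := weighted_perm_mul_conj mP (weighted_perm_perm_op bt).
rewrite -TE => /weighted_perm_uniq /[apply] -[n|_ tt'].
  by rewrite mulr1 divr_gt0.
by rewrite TE (_ : t = t') -?TE'//; exact/funext.
Qed.

Lemma perm_operators_lattice_automorphism m T : linfty_pp m ->
  perm_operators T ->
  lattice_automorphism (mul_op m \o T \o mul_op (fun n => (m n)^-1)).
Proof.
move=> mP [s [t [stK tsK ->]]].
have m0 n : 0 < m n by have [_ [d d0 dm]] := mP; exact: lt_le_trans (dm n).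
have bt : bijective t by exists s.
have bs : bijective s by exists t.
have := weighted_perm_mul_conj mP (weighted_perm_perm_op bt).
apply: weighted_perm_lattice_automorphism => [n|].
  by rewrite mulr1 divr_ge0// ltW.
apply: bij_comp; [apply: bij_comp|].
- by exists (mul_op (fun n => (m n)^-1)); [exact: mul_opK|exact: mul_opVK].
- exists (perm_op s) => x; apply: coord_ext => n.
    by rewrite !coord_perm_op//= stK.
  by rewrite !coord_perm_op//= tsK.
- by exists (mul_op m); [exact: mul_opVK|exact: mul_opK].
Qed.

(** * Uniform boundedness of the weights *)

(* Gliding hump: if w_i > 4^i is the weight at k_i of T_i in G, the orbit of
   x = sum_i 2^-i e_(t_i k_i) is unbounded, as |T_i x| >= w_i 2^-i. *)
Lemma weighted_perm_bounded (G : set (E -> E)) :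
  compact (G : set {ptws E -> E}) -> exists M, forall T w t n,
    G T -> (forall n, 0 < w n) -> weighted_perm T w t -> w n <= M.
Proof.
move=> cG; apply: contrapT => /forallNP unb.
(* The pair [a i] consists of the index read by the operator and the index at which the large weight
   occurs. *)
have /choice[a aP] i : exists a : nat * nat, exists T (c : R),
    [/\ G T, 4 ^+ i < c & forall x, coord (T x) a.2 = c * coord x a.1].
  apply: contrapT => /forallNP noa; apply: (unb (4 ^+ i)) => T w t n GT w0 Twt.
  rewrite leNgt; apply/negP => wn; apply: (noa (t n, n)).
  by exists T, (w n).
pose u i : E := 2^-1 ^+ i *: unit_vec (a i).1.
have u_cvg : cvgn (series u).
  apply: normed_cvg.
  rewrite (_ : [normed series u] = series (geometric 1 2^-1)).
    apply: is_cvg_geometric_series.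
    by rewrite ger0_norm ?invr_ge0// invf_lt1 ?ltr1n.
  apply/funext => n; rewrite /series/=; apply: eq_bigr => i _.
  rewrite /u normrZ norm_unit_vec mulr1 mul1r.
  by rewrite ger0_norm// exprn_ge0// invr_ge0.
pose x := limn (series u).
(* All terms of the series have nonnegative coordinates, so nothing cancels even if the indices
   [(a i).1] repeat. *)
have x_ge i : 2^-1 ^+ i <= coord x (a i).1.
  have cx : (fun n => coord (series u n) (a i).1) @ \oo --> coord x (a i).1.
    apply: (cvg_comp (series u) (fun z : E => coord z (a i).1) u_cvg).
    exact: coord_continuous.
  rewrite -(cvg_lim _ cx)//; apply: limr_ge; first exact: cvgP cx.
  (* [series u n] sums the indices below [n], so term [i] is present from [i.+1] on. *)
  exists i.+1 => // n /= ni; rewrite /series/=.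
  rewrite (big_morph (fun z => coord z _) (fun y z => coordD y z _) (coord0 _)).
  rewrite (bigD1_seq i) ?mem_index_iota ?iota_uniq//=.
  rewrite /u coordZ coord_unit_vec eqxx mulr1 lerDl sumr_ge0// => k _.
  by rewrite coordZ coord_unit_vec mulr_ge0// exprn_ge0// invr_ge0.
(* The orbit of [x] is the image of [G] under the continuous evaluation at [x]. *)
have /compact_bounded/bounded_set_le[B xB] : compact [set T x | T in G].
  apply: (@continuous_compact {ptws E -> E} E (fun T => T x)) => //.
  exact/continuous_subspaceT/(@ptws_eval_continuous E E).
have pow2_le i : 2 ^+ i <= `|B|.
  have [T [c [GT c4 Tc]]] := aP i.
  apply: le_trans (ler_norm B); apply: le_trans (xB (T x) _); last by exists T.
  apply: le_trans (coord_le_norm _ (a i).2).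
  rewrite Tc; apply: le_trans (ler_norm _).
  apply: (@le_trans _ _ (4 ^+ i * 2^-1 ^+ i)).
    by rewrite -exprMn (_ : 4 = 2 * 2)// ?mulfK// -natrM.
  by rewrite ler_pM ?exprn_ge0 ?invr_ge0// ltW.
(* The contradiction is [n <= 2 ^ n <= |B| < n] for the Archimedean bound [n]. *)
have := archi_boundP (normr_ge0 B).
set n := Num.bound _; apply/negP; rewrite -leNgt.
apply: le_trans (pow2_le n); rewrite -natrX ler_nat.
exact/ltnW/ltn_expl.
Qed.

(** * The cocycle identity and the choice of [m] *)

(** The conjugated weight at [n] is [(m n)^-1 * w n * m (t n)], which the cocycle identity makes 1.
    The double inverse is what [mul_conj] produces for the sequence of inverses. *)
Lemma mul_conj_perm_operators_of_cocycle m T w t s : linfty_pp m ->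
  cancel s t -> cancel t s -> weighted_perm T w t ->
  (forall n, w n * m (t n) = m n) ->
  perm_operators (mul_op (fun n => (m n)^-1) \o T \o
    mul_op (fun n => (m n)^-1^-1)).
Proof.
move=> mP stK tsK Twt wm; exists s, t; split => //.
have [_ [d d0 dm]] := mP.
have m0 n : m n != 0 by rewrite gt_eqF// (lt_le_trans d0).
apply/funext => x; apply: coord_ext => n.
rewrite (weighted_perm_mul_conj (linfty_ppV mP) Twt).
rewrite weighted_perm_perm_op; last by exists s.
by rewrite invrK -(mulrA (m n)^-1) wm mulVf.
Qed.

Lemma exists_cocycle_bound (G : set (E -> E)) : compact_group G ->
  G `<=` lattice_automorphism ->
  exists2 m : nat -> R, linfty_pp m & forall T w t n, G T ->
    (forall n, 0 < w n) -> bijective t -> weighted_perm T w t ->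
    w n * m (t n) = m n.
Proof.
move=> [G1 GM GV cG] GL.
have [M GleM] := weighted_perm_bounded cG.
pose W n : set R := [set c | exists T w t,
  [/\ G T, forall n, 0 < w n, weighted_perm T w t & c = w n]].
have W1 n : W n 1.
  by exists id, (fun=> 1), id; split => //; exact: weighted_perm_id.
have WM n : ubound (W n) M.
  by move=> _ [T [w [t [GT w0 Twt ->]]]]; exact: GleM Twt.
have supW n : has_sup (W n) by split; [exists 1|exists M].
pose m n := sup (W n).
have m1 n : 1 <= m n by exact: sup_upper_bound.
have mM n : m n <= M by apply: ge_sup => //; exists 1.
have cocycle_le T w t n : G T -> (forall n, 0 < w n) -> weighted_perm T w t ->
    w n * m (t n) <= m n.
  (* Bounding the supremum [m (t n)] by [m n / w n] reduces to one weight [v (t n)] of some [S] in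
     [G]; then [w n * v (t n)] is the weight of [T \o S] at [n]. *)
  move=> GT w0 Twt; rewrite mulrC -ler_pdivlMr//.
  apply: ge_sup; first by exists 1.
  move=> _ [S [v [r [GS v0 Svr ->]]]]; rewrite ler_pdivlMr// mulrC.
  apply: sup_upper_bound => //.
  exists (T \o S), (fun n => w n * v (t n)), (r \o t); split => //.
  - exact: GM.
  - by move=> k; rewrite mulr_gt0.
  - exact: weighted_perm_comp.
exists m.
  split; last by exists 1.
  exists M; split; first exact: num_real.
  move=> c Mc n _ /=; rewrite ger0_norm ?(le_trans ler01)//.
  exact: le_trans (ltW Mc).
move=> T w t n GT w0 bt Twt; apply/eqP; rewrite eq_le (cocycle_le T)//=.
have [S [GS TSK STK]] := GV _ GT.
have [v [_ [r [_ _ v0 Svr]]]] := lattice_automorphism_weighted_perm (GL _ GS).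
have := weighted_perm_comp Svr Twt.
(* Comparing [S \o T] with the identity gives [r (t n) = n] and [v (t n) * w n = 1]. The inequality
   for the inverse [S] at [t n], multiplied by [w n], is then the missing one. *)
rewrite (_ : S \o T = id); last exact/funext.
move=> /(weighted_perm_uniq _ weighted_perm_id) [//|vw rt].
have /= /esym/(bij_inj bt) rtK := rt (t n).
have := cocycle_le S v r (t n) GS v0 Svr.
have := vw (t n); rewrite rtK => vw1.
by rewrite -(ler_pM2l (w0 n)) mulrA [w n * v _]mulrC -vw1 mul1r.
Qed.

End WeightedPermutations.

Theorem theorem5p3 (R : realType) (E : symSeqSpace R)
    (hE : order_continuous_norm E \/ is_linfty E) :
  (forall G : set (E -> E),
     compact_group G -> G `<=` lattice_automorphism ->
     exists! H : set (E -> E),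
       [/\ compact_group H, H `<=` perm_operators &
           exists2 m : nat -> R, linfty_pp m & G = mul_conj m H]) /\
  (forall (H : set (E -> E)) (m : nat -> R),
     compact_group H -> H `<=` perm_operators -> linfty_pp m ->
     compact_group (mul_conj m H : set (E -> E)) /\
     (mul_conj m H : set (E -> E)) `<=` lattice_automorphism).
Proof.
split=> [G cG GL|H m cH HP mP]; last first.
  split; first exact: compact_group_mul_conj.
  by move=> _ [T /HP PT <-]; exact: perm_operators_lattice_automorphism.
have [m mP mG] := exists_cocycle_bound cG GL.
have HP : mul_conj (fun n => (m n)^-1) G `<=` perm_operators.
  move=> _ [T GT <-].
  have [w [s [t [stK tsK w0 Twt]]]] :=
    lattice_automorphism_weighted_perm (GL _ GT).
  apply: (mul_conj_perm_operators_of_cocycle mP stK tsK Twt) => // n.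
  by apply: mG Twt => //; exists s.
exists (mul_conj (fun n => (m n)^-1) G); split.
  split => //; first exact: compact_group_mul_conj (linfty_ppV mP) cG.
  by exists m => //; rewrite mul_conjK.
move=> H' [_ HP' [m' mP' GE]].
(* Both groups have conjugate [G], one through [m] and the other through [m']. *)
apply/seteqP; split.
- by apply: (mul_conj_perm_operators_sub mP mP' HP HP'); rewrite mul_conjK.
- by apply: (mul_conj_perm_operators_sub mP' mP HP' HP); rewrite mul_conjK.
Qed.
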